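(* Let $n\ge 1$, let $w\in\mathbb{R}^n$ have all entries strictly positive, let $b\in\mathbb{R}$, and let $\sigma:\mathbb{R}\to\mathbb{R}$ be a continuous function satisfying the STFE property. Define $f:[0,1]^n\to\mathbb{R}$ by $f(x)=\sigma(w^\top x+b)$. Let $\hat z$ be the tie point of $\sigma$ over $[b,\,w^\top\mathbf{1}+b]$, and let $R_f,R_l,R_1,\dots,R_n\subseteq[0,1]^n$ be the regions associated with $w,b,\hat z$. Then for every $x\in[0,1]^n$, \[ \mathrm{conc}(f,[0,1]^n)(x)=\begin{cases} f(x) & \text{if } x\in R_f,\\[2pt] \sigma(b)+\dfrac{\sigma(\hat z)-\sigma(b)}{\hat z-b}\,(w^\top x) & \text{if } x\in R_l,\\[6pt] \sigma(b)+x_i\,\mathrm{conc}\big(f_{-i}-\sigma(b),[0,1]^{n-1}\big)\!\left(\dfrac{x_{-i}}{x_i}\right) & \text{if } x\in R_i,\ i=1,\dots,n.\end{cases} \]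
   Context: Concave envelope: for a convex set $S\subseteq\mathbb{R}^m$ and $\phi:S\to\mathbb{R}$, $\mathrm{conc}(\phi,S)$ is the smallest concave function on $S$ that is $\ge\phi$ on $S$. STFE (secant-then-function envelope) property: a continuous function $\sigma:\mathbb{R}\to\mathbb{R}$ satisfies STFE if for every interval $[\ell,u]\subseteq\mathbb{R}$ there is $\hat z\in[\ell,u]$ such that $\mathrm{conc}(\sigma,[\ell,u])(z)=\sigma(\ell)+\frac{\sigma(\hat z)-\sigma(\ell)}{\hat z-\ell}(z-\ell)$ for $z\in[\ell,\hat z)$ and $\mathrm{conc}(\sigma,[\ell,u])(z)=\sigma(z)$ for $z\in[\hat z,u]$. For fixed $[\ell,u]$, the smallest such $\hat z$ is called the tie point of $\sigma$ over $[\ell,u]$. Regions associated with $w,b,\hat z$: $R_f=\{x\in[0,1]^n: w^\top x+b\ge\hat z\}$; $R_l=\{x\in[0,1]^n: w^\top x+b<\hat z,\ w^\top x+b\|x\|_\infty\ge\hat z\|x\|_\infty\}$; for $i=1,\dots,n$, $R_i=\{x\in[0,1]^n: w^\top x+b\|x\|_\infty<\hat z\|x\|_\infty,\ x_i>x_j\ \forall j<i,\ x_i\ge x_j\ \forall j\ge i\}$. These sets partition $[0,1]^n$ (some may be empty). Notation: $\mathbf{1}$ is the all-ones vector; $x_{-i}\in\mathbb{R}^{n-1}$ is $x$ with the $i$-th coordinate deleted; $f_{-i}:[0,1]^{n-1}\to\mathbb{R}$ is $f_{-i}(x_{-i})=f(x_1,\dots,x_{i-1},1,x_{i+1},\dots,x_n)$.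 *)

(* Defs.v *)
From HB Require Import structures.
From mathcomp Require Import all_boot all_order all_algebra.
From mathcomp Require Import interval_inference.
From mathcomp Require Import all_classical all_reals all_analysis.

Set Implicit Arguments.
Unset Strict Implicit.
Unset Printing Implicit Defensive.

Import Order.TTheory GRing.Theory Num.Theory.
Import numFieldNormedType.Exports.

Local Open Scope classical_set_scope.
Local Open Scope ring_scope.

Definition concave_function (R : realType) (V : lmodType R) (S : set V)
    (g : V -> R) : Prop :=
  convex_function S (fun x => - g x).

Definition concave_majorant (R : realType) (V : lmodType R) (phi : V -> R)
    (S : set V) (g : V -> R) : Prop :=
  concave_function S g /\ (forall x, S x -> phi x <= g x).

Definition is_concave_envelope (R : realType) (V : lmodType R) (phi : V -> R)
    (S : set V) (g : V -> R) : Prop :=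
  concave_majorant phi S g /\
  (forall h, concave_majorant phi S h -> forall x, S x -> g x <= h x).

(* Functions on S are represented by total functions on V, whose values
   outside S are irrelevant.  By minimality the envelope is determined on S;
   it exists as soon as phi is bounded above on S, see [concP]. *)
Definition conc (R : realType) (V : lmodType R) (phi : V -> R) (S : set V) :
    V -> R :=
  xget (fun=> 0) [set g | is_concave_envelope phi S g].

Lemma concP (R : realType) (V : lmodType R) (phi : V -> R) (S : set V) (M : R) :
  (forall x, S x -> phi x <= M) -> is_concave_envelope phi S (conc phi S).
Proof.
move=> phiM; apply: xgetPex.
pose Y x := [set h x | h in [set h | concave_majorant phi S h]].
have Y0 x : Y x !=set0.
  exists M, (fun=> M) => //; split=> // t a b _ _.
  by rewrite convmm.
have Ylb x : S x -> lbound (Y x) (phi x).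
  by move=> Sx _ [h [_ hphi] <-]; exact: hphi.
have Yle x h : S x -> concave_majorant phi S h -> inf (Y x) <= h x.
  by move=> Sx hh; apply: ge_inf; [exists (phi x); exact: Ylb | exists h].
exists (fun x => inf (Y x)); split; last by move=> h hh x Sx; exact: Yle.
split; last by move=> x Sx; apply: lb_le_inf => //; exact: Ylb.
move=> t x y xS yS; rewrite -convN lerN2.
apply: lb_le_inf => // _ [h hh <-].
have := hh.1 t x y xS yS; rewrite -convN lerN2; apply: le_trans.
rewrite inE in xS; rewrite inE in yS.
rewrite !convRE; apply: lerD; apply: ler_wpM2l => //; try exact: Yle.
by rewrite subr_ge0.
Qed.

Definition secant_then_function (R : realType) (sigma : R -> R) (l u zhat : R) :
    Prop :=
  let c : R -> R := conc (V := R^o) sigma `[l, u] in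
  [/\ l <= zhat <= u,
      forall z, l <= z < zhat ->
        c z = sigma l + (sigma zhat - sigma l) / (zhat - l) * (z - l)
    & forall z, zhat <= z <= u -> c z = sigma z].

Definition STFE (R : realType) (sigma : R -> R) : Prop :=
  forall l u : R, l <= u -> exists zhat, secant_then_function sigma l u zhat.

Definition is_tie_point (R : realType) (sigma : R -> R) (l u zhat : R) : Prop :=
  secant_then_function sigma l u zhat /\
  (forall z, secant_then_function sigma l u z -> zhat <= z).

Definition dot (R : realType) (n : nat) (w x : 'cV[R]_n) : R :=
  (w^T *m x) ord0 ord0.

Definition unit_cube {R : realType} (n : nat) : set 'cV[R]_n :=
  [set x | forall i, 0 <= x i ord0 <= 1].
Arguments unit_cube {R} n _.

(* (y_1, ..., y_(i-1), 1, y_i, ..., y_(n-1)): the value 1 is inserted at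
   position i, so that [row' i (insert1 i y) = y]. *)
Definition insert1 (R : realType) (n : nat) (i : 'I_n) (y : 'cV[R]_n.-1) :
    'cV[R]_n :=
  \col_j (if unlift i j is Some k then y k ord0 else 1).

Definition restrict1 (R : realType) (n : nat) (i : 'I_n) (f : 'cV[R]_n -> R) :
    'cV[R]_n.-1 -> R :=
  fun y => f (insert1 i y).

(* In these regions [`|x|] is the library norm on matrices, i.e. the sup norm
   of x. *)
Definition region_f (R : realType) (n : nat) (w : 'cV[R]_n) (b zhat : R) :
    set 'cV[R]_n :=
  [set x | unit_cube n x /\ zhat <= dot w x + b].

Definition region_l (R : realType) (n : nat) (w : 'cV[R]_n) (b zhat : R) :
    set 'cV[R]_n :=
  [set x | [/\ unit_cube n x, dot w x + b < zhat
             & zhat * `|x| <= dot w x + b * `|x|]].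

Definition region (R : realType) (n : nat) (w : 'cV[R]_n) (b zhat : R)
    (i : 'I_n) : set 'cV[R]_n :=
  [set x | [/\ unit_cube n x, dot w x + b * `|x| < zhat * `|x|,
               forall j : 'I_n, (j < i)%N -> x j ord0 < x i ord0
             & forall j : 'I_n, (i <= j)%N -> x j ord0 <= x i ord0]].

(* Main.v *)
(** Put h(v) = sigma(b + v) - sigma(b) and V = zhat - b.  STFE on the intervals
    [b, u'] makes the chord slope h(v)/v nondecreasing on (0, V], and past V the
    chord slope is at most h(V)/V; hence h lies below a function g with g(v)/v
    nondecreasing on (0, +oo), namely h prolonged linearly after V.

    On R_f and R_l the envelope is at most that of sigma evaluated at
    w.x + b, and at least the interpolation along the ray from 0.

    On R_i the upper bound bears on means of f over finitely many weighted
    points of total mass 1 with barycenter x.  Deleting the point with the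
    smallest w.y and raising the coordinates of the other ones so as to keep the
    barycenter does not decrease the mean of g(w.y), because the smallest chord
    slope is traded for larger ones.  This reduces the total mass until it
    reaches |x| = x_i, and then every point has i-th coordinate 1.  Jensen's
    inequality on that facet concludes, for the facet envelope replaced by
    the linear function (h(V)/V) w.y where w.y > V. *)

Require Import Defs.
From HB Require Import structures.
From mathcomp Require Import all_boot all_order all_algebra.
From mathcomp Require Import interval_inference.
From mathcomp Require Import all_classical all_reals all_analysis.
From mathcomp Require Import ring lra.

Set Implicit Arguments.
Unset Strict Implicit.
Unset Printing Implicit Defensive.

Import Order.TTheory GRing.Theory Num.Theory.
Import numFieldNormedType.Exports.

Local Open Scope classical_set_scope.
Local Open Scope ring_scope.

(** * Convexity and concavity with explicit real weights *)

Lemma convex_setP (R : realType) (V : lmodType R) (S : set V) :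
  convex_set S <->
  (forall t x y, S x -> S y -> 0 <= t <= 1 -> S (t *: x + (1 - t) *: y)).
Proof.
split=> [cS t x y Sx Sy /andP[t0 t1]|cS x y t].
  exact: set_mem (cS x y (Itv01 t0 t1) (mem_set Sx) (mem_set Sy)).
by rewrite !inE => Sx Sy; apply: cS => //; apply/andP; split.
Qed.

Lemma concave_functionP (R : realType) (V : lmodType R) (S : set V)
    (g : V -> R) :
  concave_function S g <->
  (forall t x y, S x -> S y -> 0 <= t <= 1 ->
    t * g x + (1 - t) * g y <= g (t *: x + (1 - t) *: y)).
Proof.
split=> [cg t x y Sx Sy /andP[t0 t1]|cg t x y].
- have := cg (Itv01 t0 t1) x y (mem_set Sx) (mem_set Sy).
  by rewrite -convN lerN2 convRE.
- rewrite !inE => Sx Sy; rewrite -convN lerN2 convRE.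
  by apply: cg => //; apply/andP; split.
Qed.

Lemma conc_le (R : realType) (V : lmodType R) (S : set V) (phi : V -> R)
    (M : R) (g : V -> R) (x : V) :
    (forall y, S y -> phi y <= M) ->
    concave_majorant phi S g -> S x -> conc phi S x <= g x.
Proof. by move=> /concP[_ +] hg Sx => /(_ _ hg _ Sx). Qed.

(** * Finite weighted families and Jensen's inequality *)

Section Atoms.
Context (R : realType) (V : lmodType R).
Implicit Types (S : set V) (phi g : V -> R) (s : seq (R * V)).

(** A list of weighted points stands for a finitely supported measure. It is not normalised, since
    the argument lowers its total mass. *)
Definition mass s : R := \sum_(a <- s) a.1.
Definition bary s : V := \sum_(a <- s) a.1 *: a.2.
Definition mean phi s : R := \sum_(a <- s) a.1 * phi a.2.
Definition atoms S s : Prop := forall a, a \in s -> 0 < a.1 /\ S a.2.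
Definition rescale t s : seq (R * V) := [seq (t * a.1, a.2) | a <- s].

Lemma mass_cons a s : mass (a :: s) = a.1 + mass s.
Proof. exact: big_cons. Qed.

Lemma bary_cons a s : bary (a :: s) = a.1 *: a.2 + bary s.
Proof. exact: big_cons. Qed.

Lemma mean_cons phi a s : mean phi (a :: s) = a.1 * phi a.2 + mean phi s.
Proof. exact: big_cons. Qed.

Lemma atoms_cons S a s :
  atoms S (a :: s) <-> [/\ 0 < a.1, S a.2 & atoms S s].
Proof.
split=> [as_|[a0 Sa as_] b]; last by rewrite inE => /predU1P[->|/as_].
have [a0 Sa] := as_ a (mem_head _ _); split=> // b bs.
by apply: as_; rewrite inE bs orbT.
Qed.

Lemma mass_ge0 S s : atoms S s -> 0 <= mass s.
Proof.
by move=> as_; rewrite /mass big_seq sumr_ge0// => a /as_[/ltW].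
Qed.

Lemma mass_rescale t s : mass (rescale t s) = t * mass s.
Proof. by rewrite /mass big_map mulr_sumr. Qed.

Lemma bary_rescale t s : bary (rescale t s) = t *: bary s.
Proof.
by rewrite /bary big_map scaler_sumr; apply: eq_bigr => a _; rewrite scalerA.
Qed.

Lemma mean_rescale phi t s : mean phi (rescale t s) = t * mean phi s.
Proof.
by rewrite /mean big_map mulr_sumr; apply: eq_bigr => a _; rewrite mulrA.
Qed.

Lemma atoms_rescale S t s : 0 < t -> atoms S s -> atoms S (rescale t s).
Proof.
by move=> t0 as_ _ /mapP[a /as_[a0 Sa] ->]; split=> //=; rewrite mulr_gt0.
Qed.

Lemma atoms_cat S s1 s2 : atoms S s1 -> atoms S s2 -> atoms S (s1 ++ s2).
Proof. by move=> a1 a2 a; rewrite mem_cat => /orP[/a1|/a2]. Qed.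

Lemma mass_cat s1 s2 : mass (s1 ++ s2) = mass s1 + mass s2.
Proof. exact: big_cat. Qed.

Lemma bary_cat s1 s2 : bary (s1 ++ s2) = bary s1 + bary s2.
Proof. exact: big_cat. Qed.

Lemma mean_cat phi s1 s2 : mean phi (s1 ++ s2) = mean phi s1 + mean phi s2.
Proof. exact: big_cat. Qed.

Lemma ler_mean S phi g s :
  (forall x, S x -> phi x <= g x) -> atoms S s -> mean phi s <= mean g s.
Proof.
move=> le_phi as_; rewrite /mean !big_seq ler_sum// => a /as_[a0 Sa].
by rewrite ler_pM2l// le_phi.
Qed.

(** Induction on the list: the normalised barycenter is a convex combination of the head and of the
    normalised barycenter of the tail. Membership in [S] is carried along because concavity is only
    available inside [S]. *)
Lemma jensen S g s : convex_set S -> concave_function S g -> atoms S s ->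
  0 < mass s ->
  S ((mass s)^-1 *: bary s) /\
  mean g s <= mass s * g ((mass s)^-1 *: bary s).
Proof.
move=> /convex_setP cS /concave_functionP cg; elim: s => [|a s IHs].
  by rewrite /mass big_nil ltxx.
move=> /atoms_cons[a0 Sa as_]; rewrite mass_cons bary_cons mean_cons => _.
have := mass_ge0 as_; rewrite le_eqVlt => /predU1P[ms0|ms0].
  (* Weights are positive, so a tail of mass 0 is empty. *)
  case: s as_ ms0 {IHs} => [_ _|c s /atoms_cons[c0 _ /mass_ge0 ms]]; last first.
    by rewrite mass_cons => h; move: c0 ms h; lra.
  rewrite /mass /bary /mean !big_nil !addr0 scalerA mulVf ?scale1r ?gt_eqF//.
have [Sb IH] := IHs as_ ms0.
set m := mass s in ms0 Sb IH *; set v := bary s in Sb IH *.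
have am : a.1 + m != 0 by rewrite gt_eqF// addr_gt0.
have t01 : 0 <= a.1 / (a.1 + m) <= 1.
  by rewrite divr_ge0 ?ler_pdivrMr; lra.
have tE : 1 - a.1 / (a.1 + m) = m / (a.1 + m) by field.
have vE : (a.1 + m)^-1 *: (a.1 *: a.2 + v) =
    a.1 / (a.1 + m) *: a.2 + (1 - a.1 / (a.1 + m)) *: (m^-1 *: v).
  rewrite tE scalerDr !scalerA; congr (_ *: _ + _ *: _); first by rewrite mulrC.
  by rewrite mulrAC mulfV ?mul1r// gt_eqF.
rewrite vE; split; first exact: cS.
have := cg _ _ _ Sa Sb t01.
rewrite -(ler_pM2l (_ : 0 < a.1 + m)) ?addr_gt0//; apply: le_trans.
rewrite tE.
have -> : (a.1 + m) * (a.1 / (a.1 + m) * g a.2 +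
   m / (a.1 + m) * g (m^-1 *: v)) = a.1 * g a.2 + m * g (m^-1 *: v).
  by field.
by rewrite lerD2l.
Qed.

(* The supremum of the means with a given barycenter is itself a concave
   majorant. *)
Lemma conc_le_mean S phi (M T : R) x :
  (forall y, S y -> phi y <= M) -> S x ->
  (forall s, atoms S s -> mass s = 1 -> bary s = x -> mean phi s <= T) ->
  conc phi S x <= T.
Proof.
move=> phiM Sx leT.
pose Y z := [set mean phi s | s in
  [set s | [/\ atoms S s, mass s = 1 & bary s = z]]].
have YM z : ubound (Y z) M.
  move=> _ [s [as_ ms _] <-].
  have := @ler_mean S phi (fun=> M) s phiM as_.
  by rewrite /mean -mulr_suml -/(mass s) ms mul1r.
have Yphi z : S z -> Y z (phi z).
  move=> Sz; exists [:: (1, z)].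
    split; first by apply/atoms_cons.
    - by rewrite /mass big_seq1.
    - by rewrite /bary big_seq1 scale1r.
  by rewrite /mean big_seq1 mul1r.
have supY z : has_ubound (Y z) by exists M; exact: YM.
apply: (@le_trans _ _ (sup (Y x))); last first.
  apply: ge_sup; first by exists (phi x); exact: Yphi.
  by move=> _ [s [as_ ms bs] <-]; exact: leT.
apply: (@conc_le _ _ _ _ M (fun z => sup (Y z))) => //.
split; last by move=> z Sz; apply: ub_le_sup => //; exact: Yphi.
apply/concave_functionP => t y z Sy Sz /andP[t0 t1].
(* The extreme weights are set apart, since rescaling by 0 would create atoms of weight 0. *)
have [->|tn0] := eqVneq t 0.
  by rewrite mul0r subr0 mul1r scale0r scale1r !add0r.
have [->|tn1] := eqVneq t 1.
  by rewrite mul1r subrr mul0r scale1r scale0r !addr0.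
have {tn0} t0 : 0 < t by rewrite lt_neqAle eq_sym tn0.
have {tn1} t1 : 0 < 1 - t by rewrite subr_gt0 lt_neqAle tn1.
(* Each supremum is isolated in turn and replaced by an arbitrary mean; the mixture of the two
   families then competes in the supremum on the right. *)
rewrite -lerBrDr mulrC -ler_pdivlMr//; apply: ge_sup.
  by exists (phi y); exact: Yphi.
move=> _ [s [as_ ms bs] <-].
rewrite ler_pdivlMr// lerBrDr addrC -lerBrDr mulrC -ler_pdivlMr//.
apply: ge_sup; first by exists (phi z); exact: Yphi.
move=> _ [s' [as' ms' bs'] <-].
rewrite ler_pdivlMr// lerBrDr; apply: ub_le_sup => //.
exists (rescale (1 - t) s' ++ rescale t s).
  split; first by apply: atoms_cat; exact: atoms_rescale.
  - by rewrite mass_cat !mass_rescale ms ms' !mulr1 subrK.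
  - by rewrite bary_cat !bary_rescale bs bs' addrC.
by rewrite mean_cat !mean_rescale mulrC [t * _]mulrC.
Qed.

End Atoms.

(** * Moving mass between points of the cube *)

Lemma dotE (R : realType) (n : nat) (w x : 'cV[R]_n) :
  dot w x = \sum_j w j ord0 * x j ord0.
Proof. by rewrite /dot mxE; apply: eq_bigr => j _; rewrite mxE. Qed.

Lemma dotD (R : realType) (n : nat) (w x y : 'cV[R]_n) :
  dot w (x + y) = dot w x + dot w y.
Proof. by rewrite /dot mulmxDr mxE. Qed.

Lemma dotZ (R : realType) (n : nat) (w x : 'cV[R]_n) (k : R) :
  dot w (k *: x) = k * dot w x.
Proof. by rewrite /dot -scalemxAr mxE. Qed.

Lemma dot_bary (R : realType) (n : nat) (w : 'cV[R]_n) s :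
  dot w (bary s) = mean (dot w) s.
Proof.
elim: s => [|a s IHs]; first by rewrite /bary /mean !big_nil /dot mulmx0 mxE.
by rewrite bary_cons mean_cons dotD dotZ IHs.
Qed.

Lemma baryE (R : realType) (n : nat) (s : seq (R * 'cV[R]_n)) j :
  bary s j ord0 = mean (fun y : 'cV[R]_n => y j ord0) s.
Proof. by rewrite /bary summxE; apply: eq_bigr => a _; rewrite mxE. Qed.

Lemma convex_cube (R : realType) (n : nat) : convex_set (unit_cube (R := R) n).
Proof.
apply/convex_setP => t x y Sx Sy /andP[t0 t1] j; rewrite !mxE.
have /andP[x0 x1] := Sx j; have /andP[y0 y1] := Sy j.
have t1' : 0 <= 1 - t by rewrite subr_ge0.
apply/andP; split; first by rewrite addr_ge0// mulr_ge0.
have := ler_wpM2l t0 x1; have := ler_wpM2l t1' y1; lra.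
Qed.

Section Dissolution.
Context (R : realType) (n : nat) (w : 'cV[R]_n) (h : R -> R).
Hypothesis w_gt0 : forall j, 0 < w j ord0.
Hypothesis h0 : h 0 = 0.
Hypothesis h_star : forall p q : R, 0 < p -> p <= q -> h p * q <= h q * p.

Let cube := unit_cube (R := R) n.
Let gain := mean (fun y : 'cV[R]_n => h (dot w y)).

Lemma dot_ge0 x : cube x -> 0 <= dot w x.
Proof.
move=> cx; rewrite dotE sumr_ge0// => j _; rewrite mulr_ge0 ?(ltW (w_gt0 _))//.
by have /andP[] := cx j.
Qed.

Lemma ler_dot (x y : 'cV[R]_n) :
  (forall j, x j ord0 <= y j ord0) -> dot w x <= dot w y.
Proof. by move=> xy; rewrite !dotE ler_sum// => j _; rewrite ler_pM2l. Qed.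

(** Strict positivity of [w] puts an atom with zero product at the origin, so that removing it
    leaves the barycenter unchanged. *)
Lemma dot_eq0 x : cube x -> dot w x = 0 -> x = 0.
Proof.
move=> cx; rewrite dotE => /eqP; rewrite psumr_eq0 => [/allP w0|j _];
    last by rewrite mulr_ge0 ?(ltW (w_gt0 _))//; have /andP[] := cx j.
apply/matrixP => j k; rewrite ord1 mxE.
have := w0 j (mem_index_enum _).
by rewrite mulf_eq0 (gt_eqF (w_gt0 _)) => /eqP.
Qed.

(** With chord slopes [a <= c <= d] at [p], [v], [v'], the increment [d * v' - c * v] is at least
    [c * (v' - v)], hence at least [a * (v' - v)]. *)
Lemma star_increment (p v v' : R) : 0 < p -> p <= v -> v <= v' ->
  h p / p * (v' - v) <= h v' - h v.
Proof.
move=> p0 pv vv'; have v0 := lt_le_trans p0 pv; have v'0 := lt_le_trans v0 vv'.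
have : h p / p <= h v / v by rewrite ler_pdivrMr// mulrAC ler_pdivlMr// h_star.
have : h v / v <= h v' / v'.
  by rewrite ler_pdivrMr// mulrAC ler_pdivlMr// h_star.
rewrite -{2}[h v'](divfK (lt0r_neq0 v'0)) -{3}[h v](divfK (lt0r_neq0 v0)).
move: (h p / p) (h v / v) (h v' / v') => a c d cd ac.
have := ler_wpM2r (ltW v'0) cd.
have : 0 <= v' - v by rewrite subr_ge0.
move=> /ler_wpM2r /(_ _ _ ac); lra.
Qed.

(* The mass [d] at [y0] is spread over the other atoms, each coordinate [j] of
   an atom [y] being moved towards 1 by the same fraction [rho j] of its
   distance to 1. *)
Lemma spread_atom s d y0 : atoms cube s -> cube y0 -> 0 <= d ->
  (forall a, a \in s -> dot w y0 <= dot w a.2) ->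
  (forall j, bary s j ord0 + d * y0 j ord0 <= mass s) ->
  exists s', [/\ size s' = size s, atoms cube s', mass s' = mass s,
    bary s' = bary s + d *: y0 & gain s + d * h (dot w y0) <= gain s'].
Proof.
move=> as_ cy0 d0 y0min room.
have := dot_ge0 cy0; rewrite le_eqVlt => /predU1P[/esym v0|v0].
  exists s; rewrite (dot_eq0 cy0 v0) scaler0 addr0; split=> //.
  by rewrite -(dot_eq0 cy0 v0) v0 h0 mulr0 addr0.
(* In coordinate [j] the atoms of [s] lie at total distance [mass s - bary s j] from 1 and must gain
   [d * y0 j]; [room] keeps the ratio at most 1. If that distance is 0, the quotient is 0 by
   convention, and [room] makes the gain 0 as well. *)
pose rho j := d * y0 j ord0 / (mass s - bary s j ord0).
have y00 j : 0 <= y0 j ord0 by have /andP[] := cy0 j.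
have dy0 j : 0 <= d * y0 j ord0 by rewrite mulr_ge0.
have rho_ge0 j : 0 <= rho j.
  by rewrite divr_ge0//; have := room j; have := dy0 j; lra.
have rhoM j : rho j * (mass s - bary s j ord0) = d * y0 j ord0.
  have [e0|ne0] := eqVneq (mass s - bary s j ord0) 0; last by rewrite divfK.
  by rewrite e0 mulr0; have := room j; have := dy0 j; lra.
have rho_le1 j : rho j <= 1.
  have [e0|ne0] := eqVneq (mass s - bary s j ord0) 0.
    by rewrite /rho e0 invr0 mulr0.
  have p0 : 0 < mass s - bary s j ord0.
    by rewrite lt_neqAle eq_sym ne0; have := room j; have := dy0 j; lra.
  by rewrite ler_pdivrMr//; have := room j; lra.
pose T (y : 'cV[R]_n) : 'cV[R]_n := \col_j (y j ord0 + rho j * (1 - y j ord0)).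
pose s' := [seq (a.1, T a.2) | a <- s].
have cT y : cube y -> cube (T y).
  move=> cy j; rewrite mxE; have /andP[y_ge0 y_le1] := cy j.
  have y'0 : 0 <= 1 - y j ord0 by rewrite subr_ge0.
  by have := ler_wpM2r y'0 (rho_le1 j); have := ler_wpM2r y'0 (rho_ge0 j); lra.
have leT y : cube y -> dot w y <= dot w (T y).
  move=> cy; apply: ler_dot => j; rewrite mxE lerDl mulr_ge0// subr_ge0.
  by have /andP[] := cy j.
have bs' : bary s' = bary s + d *: y0.
  apply/matrixP => j k; rewrite ord1 baryE !mxE baryE -rhoM baryE /mean big_map.
  rewrite mulrBr {1}/mass !mulr_sumr -sumrB -big_split.
  apply: eq_bigr => a _ /=.
  by rewrite mxE; ring.
exists s'; split=> //; first by rewrite size_map.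
- by move=> _ /mapP[a /as_[a0 ca] ->]; split=> //; exact: cT.
- by rewrite /mass big_map.
(* The loss is [c] times the total rise of the products, and by minimality of [y0] each atom gains
   at least [c] times its own rise. *)
set c := h (dot w y0) / dot w y0.
have -> : d * h (dot w y0) = c * (dot w (bary s') - dot w (bary s)).
  by rewrite bs' dotD dotZ addrAC subrr add0r mulrCA divfK ?gt_eqF.
rewrite addrC -lerBrDr !dot_bary /gain /mean !big_map -!sumrB mulr_sumr.
rewrite !big_seq ler_sum// => a sa; have [a0 ca] := as_ _ sa.
rewrite -!mulrBr mulrCA ler_pM2l//; apply: star_increment => //=.
  exact: y0min.
exact: leT.
Qed.

Lemma exists_min_atom s : s != [::] :> seq (R * 'cV[R]_n) ->
  exists a s', perm_eq s (a :: s') /\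
    forall c, c \in s' -> dot w a.2 <= dot w c.2.
Proof.
pose r (a c : R * 'cV[R]_n) := dot w a.2 <= dot w c.2.
have r_total : total r by move=> a c; exact: le_total.
have r_trans : transitive r by move=> a c e; exact: le_trans.
move=> s0; have := sort_sorted r_total s; have := permEl (perm_sort r s).
case: (sort r s) => [s_nil|a s' /[1!perm_sym] ps].
  by move: s0; rewrite -size_eq0 -(perm_size s_nil).
move=> /= /(order_path_min r_trans)/allP min_a.
by exists a, s'.
Qed.

(** Induction on the number of atoms: the atom with least product is spread over the others,
    entirely while the mass left is at least [M], and otherwise just enough to land on [M]. The
    bound of the barycenter by [M] provides the room required by [spread_atom]. *)
Lemma reduce_mass s M : atoms cube s -> 0 <= M <= mass s ->
  (forall j, bary s j ord0 <= M) ->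
  exists s', [/\ atoms cube s', mass s' = M, bary s' = bary s
    & gain s <= gain s'].
Proof.
move: {2}(size s) (leqnn (size s)) => N.
elim: N s => [|N IHN] s sN as_ /andP[M0 Ms] bM.
  move: sN Ms; rewrite leqn0 size_eq0 => /eqP -> Ms; exists [::]; split=> //.
  by apply/eqP; rewrite eq_le Ms andbT /mass big_nil.
have := Ms; rewrite le_eqVlt => /predU1P[MsE|{}Ms]; first by exists s.
have s0 : s != [::].
  by apply: contraTneq Ms => ->; rewrite /mass big_nil -leNgt.
have [a [t [pst min_a]]] := exists_min_atom s0.
have massE : mass s = a.1 + mass t by rewrite -mass_cons; exact: perm_big.
have baryE : bary s = a.1 *: a.2 + bary t.
  by rewrite -bary_cons; exact: perm_big.
have gainE : gain s = a.1 * h (dot w a.2) + gain t.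
  by rewrite /gain -(mean_cons (fun y => h (dot w y))); exact: perm_big.
have /atoms_cons[a0 ca at_] : atoms cube (a :: t).
  by move=> c; rewrite -(perm_mem pst) => /as_.
have bj j : bary s j ord0 = a.1 * a.2 j ord0 + bary t j ord0.
  by rewrite baryE !mxE.
have [aM|Ma] := lerP M (mass t).
- have [|t' [st' at' mt' bt' gt']] :=
    spread_atom (d := a.1) at_ ca (ltW a0) min_a.
    by move=> j; rewrite addrC -bj (le_trans (bM j)).
  have [|||s' [as' ms' bs' gs']] := IHN t' _ at'.
  + by rewrite st' -ltnS (leq_trans _ sN)// (perm_size pst).
  + by rewrite M0 mt' aM.
  + by move=> j; rewrite bt' addrC -baryE.
  exists s'; split=> //; first by rewrite bs' bt' baryE addrC.
  by apply: le_trans gs'; rewrite gainE addrC.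
(* Only the excess [d] is spread; the rest of the atom stays in the list and receives its share. *)
- pose d := mass s - M.
  have d0 : 0 < d by rewrite subr_gt0.
  have ad0 : 0 < a.1 - d by rewrite /d massE; lra.
  have massE' : mass ((a.1 - d, a.2) :: t) = M.
    by rewrite mass_cons /d massE /=; ring.
  have baryE' : bary ((a.1 - d, a.2) :: t) + d *: a.2 = bary s.
    by rewrite bary_cons baryE /= addrAC -scalerDl subrK.
  have [|c|j|t' [_ at' mt' bt' gt']] :=
    spread_atom (s := (a.1 - d, a.2) :: t) (d := d) _ ca (ltW d0).
  + by apply/atoms_cons.
  + by rewrite inE => /predU1P[->//|/min_a].
  + by rewrite massE'; have := bM j; rewrite -baryE' !mxE.
  exists t'; split=> //; first by rewrite mt' massE'.
    by rewrite bt' baryE'.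
  by apply: le_trans gt'; rewrite gainE /gain mean_cons /=; lra.
Qed.

End Dissolution.

(** * Chord slopes of STFE functions *)

Lemma conc_itvP (R : realType) (sigma : R -> R) (l u : R) :
  continuous sigma -> l <= u ->
  is_concave_envelope (V := R^o) sigma `[l, u]
    (conc (V := R^o) sigma `[l, u]).
Proof.
move=> csigma lu.
have [c _ maxc] := EVT_max lu (continuous_subspaceT csigma).
by apply: (concP (M := sigma c)) => x xlu; apply: maxc.
Qed.

(** This is concavity at [x] between [l] and [y], with slopes cross-multiplied so that [x] or [y]
    may equal [l]. *)
Lemma concave_chord (R : realType) (l u x y : R) (c : R -> R) :
  concave_function (V := R^o) `[l, u] c -> l <= x -> x <= y -> y <= u ->
  (c y - c l) * (x - l) <= (c x - c l) * (y - l).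
Proof.
move=> /concave_functionP cc lx xy yu; have ly := le_trans lx xy.
have [yl|yl] := eqVneq y l.
  have -> : x = l by apply/eqP; rewrite eq_le lx -yl xy.
  by rewrite yl.
have yl0 : 0 < y - l by rewrite subr_gt0 lt_neqAle eq_sym yl.
have t01 : 0 <= (x - l) / (y - l) <= 1.
  by rewrite divr_ge0 ?ler_pdivrMr ?mul1r ?lerB ?subr_ge0.
have := cc _ y l _ _ t01; rewrite /= !in_itv /= ly yu lexx (le_trans ly yu).
move=> /(_ isT isT).
have -> : (x - l) / (y - l) *: (y : R^o) + (1 - (x - l) / (y - l)) *: (l : R^o)
    = x.
  by rewrite /GRing.scale /=; field; rewrite gt_eqF.
have -> : (x - l) / (y - l) * c y + (1 - (x - l) / (y - l)) * c l =
    c l + (c y - c l) * (x - l) / (y - l) by field; rewrite gt_eqF.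
by rewrite -lerBrDl ler_pdivrMr.
Qed.

Section STFE_theory.
Context (R : realType) (sigma : R -> R).
Hypothesis csigma : continuous sigma.

Let env l u : R -> R := conc (V := R^o) sigma `[l, u].

Lemma env_concave l u : l <= u ->
  concave_function (V := R^o) `[l, u] (env l u).
Proof. by move=> /(conc_itvP csigma)[[]]. Qed.

Lemma env_ge l u x : l <= x <= u -> sigma x <= env l u x.
Proof.
move=> lxu; have lu : l <= u by case/andP: lxu; exact: le_trans.
have [[_ + _]] := conc_itvP csigma lu; apply.
by rewrite /= in_itv.
Qed.

Section Tie.
Context (l u z : R).
Hypothesis tie : secant_then_function sigma l u z.

Lemma tie_bounds : l <= z <= u.
Proof. by have [] := tie. Qed.

Lemma env_tie x : z <= x <= u -> env l u x = sigma x.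
Proof. by have [_ _] := tie; apply. Qed.

Lemma env_secant x : l < z -> l <= x <= z ->
  env l u x = sigma l + (sigma z - sigma l) / (z - l) * (x - l).
Proof.
move=> lz /andP[lx]; rewrite le_eqVlt => /predU1P[->|xz].
  have /andP[_ zu] := tie_bounds.
  by rewrite env_tie ?lexx// divfK ?subr_eq0 ?gt_eqF// addrC subrK.
by have [_ + _] := tie; apply; rewrite lx.
Qed.

Lemma env_left : env l u l = sigma l.
Proof.
have /andP[lz zu] := tie_bounds; move: lz.
rewrite le_eqVlt => /predU1P[zl|lz]; last first.
  by rewrite env_secant ?lexx ?ltW// subrr mulr0 addr0.
by rewrite env_tie// -zl lexx zl.
Qed.

(** Up to the tie point the envelope is the chord, and it dominates [sigma]. *)
Lemma slope_before_tie x : l < z -> l <= x <= z ->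
  (sigma x - sigma l) * (z - l) <= (sigma z - sigma l) * (x - l).
Proof.
move=> lz lxz; have /andP[_ zu] := tie_bounds; have /andP[lx xz] := lxz.
have := @env_ge l u x; rewrite lx (le_trans xz zu) => /(_ isT).
by rewrite env_secant// -lerBlDl mulrAC ler_pdivlMr ?subr_gt0.
Qed.

(** The concave envelope coincides with [sigma] at [l], [x] and [y]. *)
Lemma slope_after_tie x y : z <= x -> x <= y -> y <= u ->
  (sigma y - sigma l) * (x - l) <= (sigma x - sigma l) * (y - l).
Proof.
move=> zx xy yu; have /andP[lz zu] := tie_bounds.
have lx := le_trans lz zx; have zy := le_trans zx xy.
have := concave_chord (env_concave (le_trans lx (le_trans xy yu))) lx xy yu.
by rewrite env_left !env_tie ?zy ?zx ?(le_trans xy yu).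
Qed.

End Tie.

(* If the slope of the chord from [l] dropped between [x] and [y], take the
   first point [r] at which it is back to its value [k] at [x].  For [q] just
   before [r] the tie point of [l, q] must lie before [y], so the chord slope
   decreases from [y] to [q], and by continuity up to [r]. *)
Lemma slope_nondecreasing l u z x y : STFE sigma ->
  secant_then_function sigma l u z -> l < x -> x <= y -> y <= z ->
  (sigma x - sigma l) * (y - l) <= (sigma y - sigma l) * (x - l).
Proof.
move=> stfe tie lx xy yz; rewrite leNgt; apply/negP => drop.
have ly := lt_le_trans lx xy; have lz := lt_le_trans ly yz.
pose k := (sigma x - sigma l) / (x - l).
(* For [v > l], the sign of [d v] compares the chord slope at [v] with [k]. *)
pose d v := sigma v - sigma l - k * (v - l).
have kx : k * (x - l) = sigma x - sigma l by rewrite divfK// subr_eq0 gt_eqF.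
have xl0 : 0 < x - l by rewrite subr_gt0.
have yl0 : 0 < y - l by rewrite subr_gt0.
have dy : d y < 0.
  rewrite /d subr_lt0 -(ltr_pM2r xl0); apply: lt_le_trans drop _.
  by rewrite mulrAC kx.
have dz : 0 <= d z.
  rewrite /d subr_ge0 -(ler_pM2r xl0) mulrAC kx.
  by apply: (slope_before_tie tie) => //; rewrite (ltW lx) (le_trans xy).
have cd : continuous d.
  move=> v; apply: cvgB; first by apply: cvgB; [exact: csigma|exact: cvg_cst].
  by apply: cvgM; [exact: cvg_cst|apply: cvgB; [exact: cvg_id|exact: cvg_cst]].
pose A := [set v | y <= v /\ 0 <= d v].
have A0 : A !=set0 by exists z.
have Alb : lbound A y by move=> v [].
pose r := inf A.
have yr : y <= r by apply: lb_le_inf.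
have infA : has_inf A by split => //; exists y.
have dr : 0 <= d r.
  rewrite leNgt; apply/negP => dr0.
  have : \forall v \near r, d v < 0 by exact: (cd r _ (lt_nbhsl dr0)).
  case/nbhs_ballP => e /= e0 He.
  have [v Av vr] := inf_adherent e0 infA.
  have rv : r <= v by apply: ge_inf => //; exists y.
  have := He v; rewrite /ball /= distrC ger0_norm ?subr_ge0// ltrBlDl vr.
  by move=> /(_ isT); have [_] := Av; rewrite leNgt => /negP.
have dlt q : y <= q < r -> d q < 0.
  move=> /andP[yq qr]; rewrite ltNge; apply/negP => dq.
  by move: qr; rewrite ltNge => /negP; apply; apply: ge_inf => //; exists y.
(* A tie point [t] of [[l, q]] beyond [y] would have chord slope at least that at [x], hence
   [0 <= d t] with [t < r], against the choice of [r]. *)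
have before q : y <= q < r ->
    (sigma q - sigma l) * (y - l) <= (sigma y - sigma l) * (q - l).
  move=> /andP[yq qr]; have lq := lt_le_trans ly yq.
  have [t tieq] := stfe l q (ltW lq); have /andP[lt tq] := tie_bounds tieq.
  have [ty|yt] := leP t y; first exact: (slope_after_tie tieq).
  have lt' := lt_trans ly yt.
  have := slope_before_tie tieq lt' (x := x).
  rewrite (ltW lx) (le_trans xy (ltW yt)) => /(_ isT).
  have := dlt t; rewrite (ltW yt) (le_lt_trans tq qr) => /(_ isT).
  rewrite /d subr_lt0 -(ltr_pM2r xl0) mulrAC kx => h1 h2.
  by have := lt_le_trans h1 h2; rewrite ltxx.
(* The sign of [e] compares chord slopes with that at [y]: [before] gives [e <= 0] on [[y, r)],
   while [e r > 0]. The intermediate value [e r / 2] is then taken before [r], a contradiction. *)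
pose e v := (sigma v - sigma l) * (y - l) - (sigma y - sigma l) * (v - l).
have ce : continuous e.
  move=> v; apply: cvgB; apply: cvgM; try exact: cvg_cst; apply: cvgB;
  by [exact: csigma|exact: cvg_cst|exact: cvg_id].
have yr' : y < r.
  by rewrite lt_neqAle yr andbT; apply: contraTneq dr => <-; rewrite -ltNge.
have ey : e y = 0 by rewrite /e subrr.
have er : 0 < e r.
  rewrite /e subr_gt0 -(ltr_pM2r xl0).
  have h1 : (sigma y - sigma l) * (x - l) * (r - l) <
      (sigma x - sigma l) * (y - l) * (r - l).
    by rewrite ltr_pM2r// subr_gt0 (lt_trans ly).
  rewrite mulrAC; apply: (lt_le_trans h1).
  rewrite -kx mulrAC [leRHS]mulrAC ler_pM2r// mulrAC ler_pM2r//.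
  by move: dr; rewrite subr_ge0.
have [|c] := IVT (v := e r / 2) yr (continuous_subspaceT ce).
  by rewrite ey min_l ?max_r ?(ltW er)//; apply/andP; split; lra.
rewrite in_itv /= => /andP[yc]; rewrite le_eqVlt => /predU1P[->|cr] ec.
  by move: er ec; lra.
have := before c; rewrite yc cr => /(_ isT).
by rewrite -subr_le0 -/(e c) ec; lra.
Qed.

End STFE_theory.

(** * The envelope on the regions *)

(** Since [g] lies below [m * l] and touches it where [l = c], switching to [m * l] beyond that
    hyperplane preserves concavity. *)
Lemma concave_glue (R : realType) (V : lmodType R) (S : set V) (g l : V -> R)
    (m c : R) :
  convex_set S -> concave_function S g ->
  (forall t x y, l (t *: x + (1 - t) *: y) = t * l x + (1 - t) * l y) ->
  (forall x, S x -> g x <= m * l x) ->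
  (forall x, S x -> l x = c -> g x = m * l x) ->
  concave_function S (fun x => if l x <= c then g x else m * l x).
Proof.
move=> /convex_setP cS /concave_functionP cg lin g_le g_eq.
pose G x := if l x <= c then g x else m * l x.
have G_le x : S x -> G x <= m * l x by rewrite /G; case: ifP => // _ /g_le.
have crossing t x y : S x -> S y -> 0 <= t <= 1 -> l x <= c -> c < l y ->
    l (t *: x + (1 - t) *: y) <= c ->
    t * g x + (1 - t) * (m * l y) <= g (t *: x + (1 - t) *: y).
  move=> Sx Sy /andP[t0 t1] xc cy; rewrite lin.
  have [->|tn1] := eqVneq t 1.
    by rewrite subrr !mul0r !mul1r scale1r scale0r !addr0.
  have {tn1} t1' : 0 < 1 - t by rewrite subr_gt0 lt_neqAle tn1.
  have yx : 0 < l y - l x by rewrite subr_gt0 (le_lt_trans xc).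
  (* The segment from [x] to [y] meets the hyperplane [l = c] at parameter [k]. *)
  set k := (c - l x) / (l y - l x).
  have kE : k * (l y - l x) = c - l x by rewrite divfK ?gt_eqF.
  move=> zc.
  have k_ge : 1 - t <= k by rewrite ler_pdivlMr//; move: zc; lra.
  have k_le1 : k <= 1 by rewrite ler_pdivrMr ?mul1r//; lra.
  have k0 : 0 < k by exact: lt_le_trans k_ge.
  pose q := k *: y + (1 - k) *: x.
  have Sq : S q by apply: cS => //; rewrite (ltW k0).
  have lq : l q = c by rewrite /q lin; move: kE; lra.
  (* The given point lies between [x] and the crossing point [q], with weight [s] at [q]; concavity
     of [g] is used on that piece only. *)
  pose s := (1 - t) / k.
  have sk : s * k = 1 - t by rewrite divfK ?gt_eqF.
  have s01 : 0 <= s <= 1.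
    by rewrite divr_ge0 ?(ltW k0) ?(ltW t1')//= ler_pdivrMr ?mul1r.
  have -> : t *: x + (1 - t) *: y = s *: q + (1 - s) *: x.
    have tE : s * (1 - k) + (1 - s) = t by rewrite mulrBr mulr1 sk; ring.
    by rewrite /q scalerDr !scalerA sk -[RHS]addrA -scalerDl tE addrC.
  have := cg _ _ _ Sq Sx s01; apply: le_trans.
  rewrite (g_eq _ Sq lq) lq.
  have st : 0 <= t - (1 - s).
    have -> : t - (1 - s) = s * (1 - k) by rewrite mulrBr mulr1 sk; ring.
    by rewrite mulr_ge0 ?subr_ge0//; case/andP: s01.
  have := ler_wpM2l st (g_le _ Sx).
  have -> : s * (m * c) = m * (s * l x + (1 - t) * (l y - l x)).
    by rewrite -sk -mulrA kE; ring.
  lra.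
apply/concave_functionP => t x y Sx Sy t01; have /andP[t0 t1] := t01.
have t1' : 0 <= 1 - t by rewrite subr_ge0.
have [zc|zc] := leP (l (t *: x + (1 - t) *: y)) c; last first.
  rewrite lin; have := ler_wpM2l t0 (G_le _ Sx).
  have := ler_wpM2l t1' (G_le _ Sy); rewrite /G; lra.
have [xc|xc] := leP (l x) c; have [yc|yc] := leP (l y) c.
- exact: cg.
- exact: crossing.
- have tK : t = 1 - (1 - t) by ring.
  rewrite addrC [X in _ <= g X]addrC {2 4}tK; apply: crossing => //.
    by rewrite t1' gerBl.
  by rewrite -tK addrC.
- move: zc; rewrite lin leNgt => /negP[].
  (* The split only serves to have one weight known to be positive. *)
  have [t12|t12] := ltP t (1 / 2); last first.
    have := ler_wpM2l t1' (ltW yc); rewrite -(ltr_pM2l (_ : 0 < t)) in xc; lra.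
  have := ler_wpM2l t0 (ltW xc).
  by rewrite -(ltr_pM2l (_ : 0 < 1 - t)) in yc; lra.
Qed.

(** * Facets of the cube and the sup norm *)

Lemma row'_insert1 (R : realType) (n : nat) (i : 'I_n) (x : 'cV[R]_n) :
  x i ord0 = 1 -> insert1 i (row' i x) = x.
Proof.
move=> xi; apply/matrixP => j k; rewrite ord1 mxE.
by case: unliftP => [l ->|->]; rewrite ?mxE.
Qed.

Lemma insert1_conv (R : realType) (n : nat) (i : 'I_n) (x y : 'cV[R]_n.-1) t :
  insert1 i (t *: x + (1 - t) *: y) =
  t *: insert1 i x + (1 - t) *: insert1 i y.
Proof.
apply/matrixP => j k; rewrite !mxE; case: unliftP => [l _|_]; rewrite ?mxE//.
by ring.
Qed.

Lemma cube_insert1 (R : realType) (n : nat) (i : 'I_n) (y : 'cV[R]_n.-1) :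
  unit_cube n.-1 y -> unit_cube n (insert1 i y).
Proof.
by move=> cy j; rewrite mxE; case: unliftP => [l _|_]; rewrite ?ler01 ?lexx.
Qed.

Lemma cube_row' (R : realType) (n : nat) (i : 'I_n) (x : 'cV[R]_n) :
  unit_cube n x -> unit_cube n.-1 (row' i x).
Proof. by move=> cx j; rewrite mxE. Qed.

Lemma ler_entry_norm (R : realType) (n : nat) (x : 'cV[R]_n) j :
  x j ord0 <= `|x|.
Proof.
apply: le_trans (ler_norm _) _.
rewrite [leRHS]/Num.Def.normr /= mx_normrE.
by apply/bigmax_geP; right; exists (j, ord0).
Qed.

Lemma norm_max_entry (R : realType) (n : nat) (x : 'cV[R]_n) i :
  unit_cube n x -> (forall j, x j ord0 <= x i ord0) -> `|x| = x i ord0.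
Proof.
move=> cx xi; apply/eqP; rewrite eq_le ler_entry_norm andbT.
have x0 j : 0 <= x j ord0 by have /andP[] := cx j.
rewrite [leLHS]/Num.Def.normr /= mx_normrE.
apply/bigmax_leP; split=> //= -[j k] _ /=.
by rewrite ord1 ger0_norm.
Qed.

(** * The envelope over the cube, and its values on [R_f] and [R_l] *)

Section Envelope.
Context (R : realType) (n : nat) (w : 'cV[R]_n) (b : R) (sigma : R -> R).
Hypothesis w_gt0 : forall i, 0 < w i ord0.
Hypothesis csigma : continuous sigma.

Let f (x : 'cV[R]_n) := sigma (dot w x + b).
Let cube := unit_cube (R := R) n.
Let u := dot w (const_mx 1) + b.
Let env : R -> R := conc (V := R^o) sigma `[b, u].
Let C := conc f cube.

Lemma cube0 : cube 0.
Proof. by move=> j; rewrite mxE lexx ler01. Qed.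

Lemma cubeZ k x : 0 <= k -> k * `|x| <= 1 -> cube x -> cube (k *: x).
Proof.
move=> k0 kx cx j; rewrite mxE; have /andP[x0 _] := cx j.
by rewrite mulr_ge0//= (le_trans _ kx)// ler_wpM2l// ler_entry_norm.
Qed.

Lemma dot_range x : cube x -> b <= dot w x + b <= u.
Proof.
move=> cx; rewrite lerDr dot_ge0//= lerD2r ler_dot// => j.
by rewrite mxE; have /andP[] := cx j.
Qed.

Lemma dot_range_le : b <= u.
Proof. by have /andP[] := dot_range cube0; exact: le_trans. Qed.

Lemma f_bounded : exists M, forall x, cube x -> f x <= M.
Proof.
have [c _ maxc] := EVT_max dot_range_le (continuous_subspaceT csigma).
by exists (sigma c) => x /dot_range; exact: maxc.
Qed.

Lemma conc_f : is_concave_envelope f cube C.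
Proof. by have [M fM] := f_bounded; exact: concP fM. Qed.

Lemma conc_f_ge x : cube x -> f x <= C x.
Proof. by have [[_ +] _] := conc_f; apply. Qed.

(** The one-variable envelope composed with an affine map is a concave majorant of [f]. *)
Lemma conc_f_le_env x : cube x -> C x <= env (dot w x + b).
Proof.
move=> cx; have [_ /(_ (fun y => env (dot w y + b)))] := conc_f; apply=> //.
split=> [|y cy]; last by apply: env_ge => //; exact: dot_range.
apply/concave_functionP => t y z cy cz t01.
have /concave_functionP ce := env_concave csigma dot_range_le.
have := ce t _ _ (dot_range cy) (dot_range cz) t01.
congr (_ <= env _); rewrite dotD !dotZ /GRing.scale /=; ring.
Qed.

(** Concavity between [y] and the origin, where [f] equals [sigma b]. *)
Lemma conc_f_ray t y : cube y -> 0 <= t <= 1 ->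
  sigma b + t * (C y - sigma b) <= C (t *: y).
Proof.
move=> cy t01; have [[/concave_functionP cC _] _] := conc_f.
have := cC t y 0 cy cube0 t01; rewrite scaler0 addr0; apply: le_trans.
have : f 0 <= C 0 by exact/conc_f_ge/cube0.
rewrite /f /dot mulmx0 mxE add0r; have /andP[_ t1] := t01.
have : 0 <= 1 - t by rewrite subr_ge0.
by move=> /ler_wpM2l h /h; lra.
Qed.

Variable zhat : R.
Hypothesis tie : secant_then_function sigma b u zhat.

Lemma conc_region_f x : region_f w b zhat x -> C x = f x.
Proof.
move=> [cx zx]; apply/eqP; rewrite eq_le conc_f_ge// andbT.
apply: le_trans (conc_f_le_env cx) _.
by rewrite /env (env_tie tie)// zx; have /andP[] := dot_range cx.
Qed.

Lemma conc_region_l x : region_l w b zhat x ->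
  C x = sigma b + (sigma zhat - sigma b) / (zhat - b) * dot w x.
Proof.
move=> [cx xz zx]; have x0 := dot_ge0 w_gt0 cx.
have bz : b < zhat by apply: le_lt_trans xz; rewrite lerDr.
apply/eqP; rewrite eq_le; apply/andP; split.
  apply: le_trans (conc_f_le_env cx) _.
  by rewrite /env (env_secant tie)// ?addrK// lerDr x0 ltW.
case: (ltgtP 0 (dot w x)) x0 => // [wx _|wx0 _]; last first.
  rewrite -wx0 mulr0 addr0.
  by have := conc_f_ge cx; rewrite /f -wx0 add0r.
have zb0 : 0 < zhat - b by rewrite subr_gt0.
(* The point [t^-1 *: x] of the ray is where the activation reaches the tie point; the condition
   defining [R_l] says that it is still in the cube. *)
pose t := dot w x / (zhat - b).
have t0 : 0 < t by rewrite divr_gt0.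
have ct : cube (t^-1 *: x).
  apply: cubeZ => //; first by rewrite invr_ge0 ltW.
  rewrite invf_div mulrAC ler_pdivrMr// mul1r; lra.
have fz : f (t^-1 *: x) = sigma zhat.
  by rewrite /f dotZ invf_div divfK ?gt_eqF// subrK.
have t1 : 0 <= t <= 1 by rewrite (ltW t0) ler_pdivrMr// mul1r; lra.
have := conc_f_ray ct t1; rewrite scalerA mulfV ?gt_eqF// scale1r.
apply: le_trans; rewrite lerD2l mulrAC -mulrA mulrC ler_pM2l// lerD2r -fz.
exact: conc_f_ge.
Qed.

(** * The regions [R_i], by reduction to a facet *)

Hypothesis stfe : STFE sigma.
Variable i : 'I_n.

Let phi := conc (fun y => restrict1 i f y - sigma b) (unit_cube n.-1).
(** The facet is kept in the ambient space, so that atoms of the cube can lie on it; [row' i]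
    carries it to the smaller cube. *)
Let facet : set 'cV[R]_n := [set y | cube y /\ y i ord0 = 1].

Lemma conc_facet : is_concave_envelope
  (fun y => restrict1 i f y - sigma b) (unit_cube n.-1) phi.
Proof.
have [M fM] := f_bounded; apply: (concP (M := M - sigma b)) => y cy.
by rewrite lerD2r; apply: fM; exact: cube_insert1.
Qed.

Lemma conc_facet_le y : unit_cube n.-1 y -> phi y <= C (insert1 i y) - sigma b.
Proof.
move=> cy; have [_ /(_ (fun z => C (insert1 i z) - sigma b))] := conc_facet.
apply=> //; split=> [|z cz]; last first.
  by rewrite lerD2r; apply: conc_f_ge; exact: cube_insert1.
apply/concave_functionP => t x z cx cz t01.
have [[/concave_functionP cC _] _] := conc_f.
have := cC t _ _ (cube_insert1 i cx) (cube_insert1 i cz) t01.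
by rewrite insert1_conv; lra.
Qed.

Lemma convex_facet : convex_set facet.
Proof.
have /convex_setP cc := @convex_cube R n.
apply/convex_setP => t x y [cx xi] [cy yi] t01; split; first exact: cc.
by rewrite !mxE xi yi; ring.
Qed.

Lemma facet_ge x : facet x -> f x - sigma b <= phi (row' i x).
Proof.
move=> [cx xi]; have [[_ ge_phi] _] := conc_facet.
by have := ge_phi _ (cube_row' i cx); rewrite /restrict1 row'_insert1.
Qed.

Hypothesis bz : b < zhat.
Let m := (sigma zhat - sigma b) / (zhat - b).
Let V := zhat - b.
(** Beyond [V] the chord slope of the activation may decrease; the linear branch freezes it at
    [m]. *)
Let h v := if v <= V then sigma (b + v) - sigma b else m * v.

Let V0 : 0 < V. Proof. by rewrite subr_gt0. Qed.

Let mV : m * V = sigma zhat - sigma b.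
Proof. by rewrite divfK ?gt_eqF. Qed.

Let h0 : h 0 = 0.
Proof. by rewrite /h (ltW V0) addr0 subrr. Qed.

Lemma before_tie_le v : 0 <= v <= V -> sigma (b + v) - sigma b <= m * v.
Proof.
move=> /andP[v0 vV]; rewrite -(ler_pM2r V0) mulrAC mV.
have := slope_before_tie csigma tie bz (x := b + v).
rewrite lerDl v0 (addrC b v) addrK -lerBrDr; exact.
Qed.

Lemma after_tie_le v : V <= v -> b + v <= u -> sigma (b + v) - sigma b <= m * v.
Proof.
move=> Vv vu; rewrite -(ler_pM2r V0) mulrAC mV.
have := slope_after_tie csigma tie (lexx zhat) _ vu.
by rewrite (addrC b v) addrK -lerBlDr; exact.
Qed.

(** Before [V] this is [slope_nondecreasing], beyond [V] the slope is constant, and across [V] it is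
    the chord bound. *)
Lemma extension_star_shaped p q : 0 < p -> p <= q -> h p * q <= h q * p.
Proof.
move=> p0 pq; rewrite /h; have [qV|Vq] := leP q V.
  rewrite (le_trans pq qV).
  have := slope_nondecreasing csigma stfe tie (x := b + p) (y := b + q).
  rewrite ltrDl p0 lerD2l pq => /(_ isT isT).
  rewrite !(addrC b) !addrK -lerBrDr; exact.
rewrite [leRHS]mulrAC; have [pV|Vp] := leP p V => //.
by rewrite ler_pM2r ?(lt_le_trans p0)// before_tie_le// pV ltW.
Qed.

Lemma activation_le_extension x : cube x -> f x - sigma b <= h (dot w x).
Proof.
move=> cx; rewrite /f (addrC _ b) /h; have [//|Vx] := leP (dot w x) V.
apply: after_tie_le; first exact: ltW.
by rewrite (addrC b); have /andP[] := dot_range cx.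
Qed.

(** On the facet [m * dot w x] is affine and dominates [f - sigma b] on both sides of the tie. *)
Lemma facet_le x : facet x -> phi (row' i x) <= m * dot w x.
Proof.
move=> [cx xi]; rewrite -{2}(row'_insert1 xi).
have := cube_row' i cx; move: (row' i x) => y cy.
have [_ /(_ (fun z => m * dot w (insert1 i z)))] := conc_facet.
apply=> //; split=> [|z cz].
  apply/concave_functionP => t y1 y2 _ _ _.
  by rewrite insert1_conv dotD !dotZ; lra.
have ci := cube_insert1 i cz.
rewrite /restrict1 /f (addrC _ b).
have /andP[h1 h2] := dot_range ci.
have [vV|Vv] := leP (dot w (insert1 i z)) V.
  by rewrite before_tie_le// vV dot_ge0.
by rewrite after_tie_le ?(ltW Vv)// addrC.
Qed.

Lemma facet_tie x : facet x -> dot w x = V -> phi (row' i x) = m * dot w x.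
Proof.
move=> fx xV; apply/eqP; rewrite eq_le facet_le//= xV mV.
by have := facet_ge fx; rewrite /f xV subrK.
Qed.

Lemma conc_region x : region w b zhat i x ->
  C x = sigma b + x i ord0 * phi ((x i ord0)^-1 *: row' i x).
Proof.
move=> [cx xz x_lt x_le].
have normx : `|x| = x i ord0.
  by apply: norm_max_entry => // j; case: (ltnP j i) => [/x_lt/ltW|/x_le].
rewrite normx in xz.
set k := x i ord0 in xz normx *.
(* The condition defining the region reads [dot w x < V * k], with a nonnegative left side. *)
have k0 : 0 < k.
  rewrite -(pmulr_rgt0 _ V0) /V; have := dot_ge0 w_gt0 cx; lra.
have k1 : k <= 1 by have /andP[] := cx i.
have ck : cube (k^-1 *: x).
  apply: cubeZ => //; first by rewrite invr_ge0 ltW.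
  by rewrite normx mulVf// gt_eqF.
have ki : (k^-1 *: x) i ord0 = 1 by rewrite mxE mulVf// gt_eqF.
rewrite -linearZ /=.
apply/eqP; rewrite eq_le; apply/andP; split; last first.
  have k01 : 0 <= k <= 1 by rewrite ltW.
  have := conc_f_ray ck k01; rewrite scalerA mulfV ?gt_eqF// scale1r.
  apply: le_trans; rewrite lerD2l ler_pM2l//.
  by rewrite -{2}(row'_insert1 ki) conc_facet_le//; exact: cube_row'.
have [M fM] := f_bounded; apply: (conc_le_mean fM) => // s as_ ms bs.
(* The mass can go down to [k] because no coordinate of [x] exceeds [k]. *)
have [||s' [as' ms' bs' hs']] :=
  reduce_mass w_gt0 h0 extension_star_shaped (M := k) as_.
- by rewrite ms k1 ltW.
- by move=> j; rewrite bs -normx ler_entry_norm.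
have fs : mean f s <= sigma b + mean (fun y => h (dot w y)) s.
  rewrite -[sigma b]mul1r -ms /mass mulr_suml -big_split /=.
  under [leRHS]eq_bigr do rewrite -mulrDr.
  apply: (ler_mean (g := fun y => sigma b + h (dot w y))) as_ => y cy.
  by rewrite -lerBlDl activation_le_extension.
apply: (le_trans fs); rewrite lerD2l; apply: (le_trans hs').
(* The mass and the [i]-th coordinate of the barycenter are both [k], so a sum of nonnegative terms
   vanishes; weights being positive, each [i]-th coordinate is 1. *)
have fac : atoms facet s'.
  have : \sum_(a <- s') a.1 * (1 - a.2 i ord0) = 0.
    have -> : \sum_(a <- s') a.1 * (1 - a.2 i ord0) = mass s' - bary s' i ord0.
      rewrite baryE /mass /mean -sumrB; apply: eq_bigr => a _.
      by rewrite mulrBr mulr1.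
    by rewrite ms' bs' bs subrr.
  have pos a : a \in s' -> 0 <= a.1 * (1 - a.2 i ord0).
    move=> /as'[a0 /(_ i)/andP[_ a1]].
    by rewrite mulr_ge0 ?(ltW a0)// subr_ge0.
  rewrite big_seq => /eqP; rewrite psumr_eq0 // => /allP s0 a as'a.
  have [a0 ca] := as' _ as'a; split=> //; split=> //.
  have := s0 a as'a. rewrite as'a /= mulf_eq0 gt_eqF//= subr_eq0.
  by move=> /eqP.
have glued := concave_glue convex_facet _ _ facet_le facet_tie.
have concave_phi : concave_function facet (fun y => phi (row' i y)).
  apply/concave_functionP => t y z [cy _] [cz _] t01.
  have [[/concave_functionP cphi _] _] := conc_facet.
  rewrite linearD !linearZ /=.
  by apply: cphi => //; exact: cube_row'.
have ldot t y z : dot w (t *: y + (1 - t) *: z) =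
    t * dot w y + (1 - t) * dot w z by rewrite dotD !dotZ.
have := jensen convex_facet (glued concave_phi ldot) fac.
rewrite ms' bs' bs => /(_ k0)[_].
(* At the barycenter [k^-1 *: x] the product is below [V], so the glued function is the facet
   envelope there. *)
rewrite ifT; last first.
  rewrite dotZ mulrC ler_pdivrMr// /V; move: xz; lra.
apply: le_trans; apply: ler_mean fac => y fy; rewrite /h.
by case: ifP => // yV; rewrite (addrC b); exact: facet_ge.
Qed.

End Envelope.

Theorem theorem1 (R : realType) (n : nat) (w : 'cV[R]_n) (b : R)
    (sigma : R -> R) (zhat : R)
    (f := fun x : 'cV[R]_n => sigma (dot w x + b)) :
  (1 <= n)%N ->
  (forall i, 0 < w i ord0) ->
  continuous sigma ->
  STFE sigma ->
  is_tie_point sigma b (dot w (const_mx 1) + b) zhat ->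
  forall x : 'cV[R]_n, unit_cube n x ->
    [/\ region_f w b zhat x ->
          conc f (unit_cube n) x = f x,
        region_l w b zhat x ->
          conc f (unit_cube n) x =
            sigma b + (sigma zhat - sigma b) / (zhat - b) * dot w x
      & forall i : 'I_n, region w b zhat i x ->
          conc f (unit_cube n) x =
            sigma b + x i ord0 *
              conc (fun y => restrict1 i f y - sigma b) (unit_cube n.-1)
                ((x i ord0)^-1 *: row' i x)].
Proof.
move=> _ w_gt0 csigma stfe [tie _] x cx; split=> [||i xi].
- exact: conc_region_f.
- exact: conc_region_l.
apply: (conc_region w_gt0 csigma tie stfe _ xi).
(* A point of [R_i] forces [b < zhat]: otherwise [zhat * |x| <= b * |x|], and adding the nonnegative
   [dot w x] contradicts membership. *)
rewrite ltNge; apply/negP => zb.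
have [_ + _ _] := xi; apply/negP; rewrite -leNgt.
by have := ler_wpM2r (normr_ge0 x) zb; have := dot_ge0 w_gt0 cx; lra.
Qed.
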